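(* Let $A$ be a Hopf algebra, $B\subseteq A$ a quantum homogeneous $A$-space, and $\Omega^1(B)$ a left $A$-covariant first-order differential calculus over $B$. For any $\mathcal{F}\in{}^A_B\mathrm{mod}_0$, and any bimodule connection $\nabla:\mathcal{F}\to\Omega^1(B)\otimes_B\mathcal{F}$, the bimodule map $\sigma$ of $\nabla$ satisfies $$\sigma(f\otimes\mathrm{d}b)=\mathrm{d}\big(f_{(-2)}\,b\,S(f_{(-1)})\big)\otimes f_{(0)},\qquad f\in\mathcal{F},\ b\in B.$$ Hence all the bimodule maps associated to left $A$-covariant connections for $\mathcal{F}$ coincide.
   Context: All algebras are unital over $\mathbb{C}$; all Hopf algebras have bijective antipode $S$; $\Delta,\varepsilon$ denote coproduct and counit, and Sweedler notation is used, with left coactions written $\Delta_L(f)=f_{(-1)}\otimes f_{(0)}$. A left coideal subalgebra $B\subseteq A$ (i.e. $\Delta(B)\subseteq A\otimes B$) is a quantum homogeneous $A$-space if $A$ is faithfully flat as a right $B$-module and $B^+A=AB^+$, where $B^+=\ker(\varepsilon|_B)$. ${}^A_B\mathrm{mod}$ is the category of relative Hopf modules that are finitely generated as left $B$-modules: left $B$-modules $\mathcal{F}$ with a left $A$-coaction $\Delta_L$ satisfying $\Delta_L(bf)=\Delta(b)\Delta_L(f)$. ${}^A_B\mathrm{mod}_0$ consists of such objects endowed with the right $B$-module structure $fb=f_{(-2)}\,b\,S(f_{(-1)})\,f_{(0)}$, for $f\in\mathcal{F}$, $b\in B$. A first-order differential calculus over $B$ is a $B$-bimodule $\Omega^1(B)$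 together with a derivation $\mathrm{d}:B\to\Omega^1(B)$ such that $\Omega^1(B)$ is generated as a left $B$-module by the elements $\mathrm{d}b$, $b\in B$; it is left $A$-covariant if there is a (necessarily unique) left $A$-coaction with $\Delta_L(b\,\mathrm{d}c)=b_{(1)}c_{(1)}\otimes b_{(2)}\mathrm{d}c_{(2)}$. A connection on $\mathcal{F}$ is a linear map $\nabla:\mathcal{F}\to\Omega^1(B)\otimes_B\mathcal{F}$ with $\nabla(bf)=\mathrm{d}b\otimes f+b\nabla(f)$; it is left $A$-covariant if it is a left $A$-comodule map. It is a bimodule connection if there is a (necessarily unique) $B$-bimodule map $\sigma:\mathcal{F}\otimes_B\Omega^1(B)\to\Omega^1(B)\otimes_B\mathcal{F}$, called its bimodule map, with $\nabla(fb)=\nabla(f)b+\sigma(f\otimes\mathrm{d}b)$ for all $f\in\mathcal{F}$, $b\in B$.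
   Formalization: The claim is false as stated; it is proved assuming that the right B-action on Ω¹(B) is the mod_0 one, wb = w_(-2) b S(w_(-1)) w_(0), and, for the formula for σ as well, that the bimodule connection ∇ is left A-covariant. *)

(* Defs.v *)
From HB Require Import structures.
From mathcomp Require Import all_boot all_order all_algebra.
From mathcomp Require Import generic_quotient.
From mathcomp Require Import boolp reals complex.

Set Implicit Arguments.
Unset Strict Implicit.
Unset Printing Implicit Defensive.

Import GRing.Theory.
Local Open Scope ring_scope.
Local Open Scope quotient_scope.

(** * Tensor product of a right R-module by a left R-module

  The two actions are explicit parameters, because the same additive group
  carries several module structures below (over the ground field and over B,
  on the left and on the right).  Elements are formal sums of pairs modulo the
  congruence generated by biadditivity and R-balancedness. *)

Section Tensor.
Variables (R : Type) (M N : zmodType) (ra : M -> R -> M) (la : R -> N -> N).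

Inductive tens_eq : seq (M * N) -> seq (M * N) -> Prop :=
| tens_eq_refl s : tens_eq s s
| tens_eq_sym s t : tens_eq s t -> tens_eq t s
| tens_eq_trans s t u : tens_eq s t -> tens_eq t u -> tens_eq s u
| tens_eq_cat s s' t t' :
    tens_eq s s' -> tens_eq t t' -> tens_eq (s ++ t) (s' ++ t')
| tens_eq_catC s t : tens_eq (s ++ t) (t ++ s)
| tens_eq_0 n : tens_eq [:: (0, n)] [::]
| tens_eq_addl m m' n : tens_eq [:: (m + m', n)] [:: (m, n); (m', n)]
| tens_eq_addr m n n' : tens_eq [:: (m, n + n')] [:: (m, n); (m, n')]
| tens_eq_bal m r n : tens_eq [:: (ra m r, n)] [:: (m, la r n)].

Definition tens_eqb (s t : seq (M * N)) : bool := `[< tens_eq s t >].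

Lemma tens_eqb_refl : reflexive tens_eqb.
Proof. by move=> s; apply/asboolP; exact: tens_eq_refl. Qed.

Lemma tens_eqb_sym : symmetric tens_eqb.
Proof. by move=> s t; apply/asboolP/asboolP; exact: tens_eq_sym. Qed.

Lemma tens_eqb_trans : transitive tens_eqb.
Proof.
by move=> t s u /asboolP st /asboolP tu; apply/asboolP; exact: tens_eq_trans tu.
Qed.

Canonical tens_equiv := EquivRel tens_eqb tens_eqb_refl tens_eqb_sym tens_eqb_trans.

Definition tens := {eq_quot tens_equiv}.

HB.instance Definition _ := Choice.on tens.
HB.instance Definition _ := EqQuotient.on tens.

Lemma tens_pi (s t : seq (M * N)) : tens_eq s t -> \pi_tens s = \pi_tens t.
Proof. by move=> st; apply/eqmodP/asboolP. Qed.

Lemma tens_reprK (s : seq (M * N)) : tens_eq (repr (\pi_tens s)) s.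
Proof. by apply/asboolP/(@eqmodP _ tens_equiv); rewrite reprK. Qed.

Definition tens_zero : tens := \pi_tens [::].
Definition tens_add (x y : tens) : tens := \pi_tens (repr x ++ repr y).
Definition tens_opp (x : tens) : tens :=
  \pi_tens [seq (- p.1, p.2) | p <- repr x].

Lemma tens_addE (s t : seq (M * N)) :
  tens_add (\pi_tens s) (\pi_tens t) = \pi_tens (s ++ t).
Proof.
by rewrite /tens_add; apply: tens_pi; apply: tens_eq_cat; exact: tens_reprK.
Qed.

Lemma tens_addA : associative tens_add.
Proof.
move=> x y z; elim/quotW: x => s; elim/quotW: y => t; elim/quotW: z => u.
by rewrite (tens_addE t u) (tens_addE s t) (tens_addE s) (tens_addE _ u) catA.
Qed.

Lemma tens_addC : commutative tens_add.
Proof.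
move=> x y; elim/quotW: x => s; elim/quotW: y => t; rewrite !tens_addE.
by apply: tens_pi; exact: tens_eq_catC.
Qed.

Lemma tens_add0 : left_id tens_zero tens_add.
Proof. by move=> x; elim/quotW: x => s; rewrite tens_addE. Qed.

Lemma tens_addN : left_inverse tens_zero tens_opp tens_add.
Proof.
move=> x; rewrite -{2}[x]reprK tens_addE; apply: tens_pi.
elim: (repr x) => [|[m n] s IHs]; first exact: tens_eq_refl.
have -> : [seq (- p.1, p.2) | p <- (m, n) :: s] ++ (m, n) :: s
   = [:: (- m, n)] ++ ([seq (- p.1, p.2) | p <- s] ++ [:: (m, n)]) ++ s.
  by rewrite -!catA.
apply: tens_eq_trans (tens_eq_cat (tens_eq_refl _)
  (tens_eq_cat (tens_eq_catC _ _) (tens_eq_refl _))) _.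
rewrite -catA catA; apply: (@tens_eq_trans _ ([::] ++ [::])); last exact: tens_eq_refl.
apply: tens_eq_cat IHs.
apply: tens_eq_trans (tens_eq_0 n); rewrite -[0](addNr m).
exact/tens_eq_sym/tens_eq_addl.
Qed.

HB.instance Definition _ :=
  GRing.isZmodule.Build tens tens_addA tens_addC tens_add0 tens_addN.

Definition tpure (m : M) (n : N) : tens := \pi_tens [:: (m, n)].

Definition balanced (G : zmodType) (beta : M -> N -> G) : Prop :=
  [/\ forall m m' n, beta (m + m') n = beta m n + beta m' n,
      forall m n n', beta m (n + n') = beta m n + beta m n'
    & forall m r n, beta (ra m r) n = beta m (la r n)].

(* The value at x of the additive map induced by beta.  Choice-independent, and
   hence meaningful, when beta is balanced (lemmas tsum_pure, tsumD). *)
Definition tsum (G : zmodType) (beta : M -> N -> G) (x : tens) : G :=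
  \sum_(p <- repr x) beta p.1 p.2.

Lemma tens_eq_sum (G : zmodType) (beta : M -> N -> G) s t :
  balanced beta -> tens_eq s t ->
  \sum_(p <- s) beta p.1 p.2 = \sum_(p <- t) beta p.1 p.2.
Proof.
case=> Dl Dr bal.
elim=> {s t} [|||s s' t t' _ IHs _ IHt|s t|n|m m' n|m n n'|m r n] //=.
- by move=> s t u _ -> _ ->.
- by rewrite !big_cat /= IHs IHt.
- by rewrite !big_cat /= addrC.
- rewrite big_seq1 big_nil /=; apply: (@addrI _ (beta 0 n)).
  by rewrite -Dl !addr0.
- by rewrite big_seq1 big_cons big_seq1 Dl.
- by rewrite big_seq1 big_cons big_seq1 Dr.
- by rewrite !big_seq1 bal.
Qed.

Lemma tsum_pure (G : zmodType) (beta : M -> N -> G) m n :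
  balanced beta -> tsum beta (tpure m n) = beta m n.
Proof.
by move=> bal; rewrite /tsum (tens_eq_sum bal (tens_reprK _)) big_seq1.
Qed.

Lemma tsumD (G : zmodType) (beta : M -> N -> G) x y :
  balanced beta -> tsum beta (x + y) = tsum beta x + tsum beta y.
Proof.
move=> bal; rewrite /tsum -big_cat /=.
exact: tens_eq_sum (tens_reprK _).
Qed.

Lemma tens_pureE (x : tens) : x = \sum_(p <- repr x) tpure p.1 p.2.
Proof.
rewrite -{1}[x]reprK; elim: (repr x) => [|[m n] s IHs]; first by rewrite big_nil.
by rewrite big_cons -IHs /=; rewrite [RHS]tens_addE.
Qed.

Lemma tpure_balanced : balanced tpure.
Proof.
split=> [m m' n|m n n'|m r n]; rewrite ?[RHS]tens_addE; apply: tens_pi.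
- exact: tens_eq_addl.
- exact: tens_eq_addr.
- exact: tens_eq_bal.
Qed.

End Tensor.

Arguments tens {R M N} ra la.
Arguments tpure {R M N} ra la m n.
Arguments tsum {R M N ra la G} beta x.

(* Sweedler notation: if x = \sum_i m_i (x) n_i then
   \sw_(m, n <- x) E m n = \sum_i E m_i n_i *)
Reserved Notation "\sw_ ( m , n <- x ) E"
  (at level 41, m name, n name, x at level 40, E at level 41,
   format "\sw_ ( m ,  n  <-  x )  E").
Notation "\sw_ ( m , n <- x ) E" := (tsum (fun m n => E) x) : ring_scope.

(* Left and right actions induced on a tensor product by an action on its left,
   respectively right, factor. *)
Definition tens_lact {R R' : Type} {M N : zmodType} {ra : M -> R -> M}
    {la : R -> N -> N} (act : R' -> M -> M) (r : R') (x : tens ra la) :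
    tens ra la :=
  \sw_(m, n <- x) tpure ra la (act r m) n.

Definition tens_ract {R R' : Type} {M N : zmodType} {ra : M -> R -> M}
    {la : R -> N -> N} (act : N -> R' -> N) (x : tens ra la) (r : R') :
    tens ra la :=
  \sw_(m, n <- x) tpure ra la m (act n r).

(** * Hopf algebras *)

(* A (x)_K V for a K-vector space V with scalar multiplication s *)
Notation atens A s := (tens (fun (a : A) k => k *: a) s).
Notation apure A s := (tpure (fun (a : A) k => k *: a) s).

Record hopfAlg (K : fieldType) := HopfAlg {
  hopf_sort :> algType K;
  comul : hopf_sort -> atens hopf_sort (@GRing.scale K hopf_sort);
  counit : hopf_sort -> K;
  antip : hopf_sort -> hopf_sort;
  comulD : forall x y, comul (x + y) = comul x + comul y;
  comulZ : forall k x, comul (k *: x) = tens_lact *:%R k (comul x);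
  comul1 : comul 1 = apure hopf_sort *:%R 1 1;
  comulM : forall x y, comul (x * y) =
    \sw_(x1, x2 <- comul x) \sw_(y1, y2 <- comul y)
      apure hopf_sort *:%R (x1 * y1) (x2 * y2);
  counitD : forall x y, counit (x + y) = counit x + counit y;
  counitZ : forall k x, counit (k *: x) = k * counit x;
  counit1 : counit 1 = 1;
  counitM : forall x y, counit (x * y) = counit x * counit y;
  comulA : forall x,
    \sw_(x1, x2 <- comul x) \sw_(y1, y2 <- comul x1)
      apure hopf_sort (tens_lact *:%R) y1 (apure hopf_sort *:%R y2 x2)
    = \sw_(x1, x2 <- comul x) apure hopf_sort (tens_lact *:%R) x1 (comul x2);
  counitl : forall x, \sw_(x1, x2 <- comul x) (counit x1 *: x2) = x;
  counitr : forall x, \sw_(x1, x2 <- comul x) (counit x2 *: x1) = x;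
  antipD : forall x y, antip (x + y) = antip x + antip y;
  antipZ : forall k x, antip (k *: x) = k *: antip x;
  antipl : forall x, \sw_(x1, x2 <- comul x) (antip x1 * x2) = (counit x)%:A;
  antipr : forall x, \sw_(x1, x2 <- comul x) (x1 * antip x2) = (counit x)%:A;
  antip_bij : bijective antip
}.

(** * Left comodules *)

Definition left_coaction (K : fieldType) (A : hopfAlg K) (V : zmodType)
    (s : K -> V -> V) (delta : V -> atens A s) : Prop :=
  [/\ forall v w, delta (v + w) = delta v + delta w,
      forall k v, delta (s k v) = tens_lact *:%R k (delta v),
      forall v,
        \sw_(a, w <- delta v) \sw_(a1, a2 <- comul a)
          apure A (tens_lact *:%R) a1 (apure A s a2 w)
        = \sw_(a, w <- delta v) apure A (tens_lact *:%R) a (delta w)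
    & forall v, \sw_(a, w <- delta v) s (counit a) w = v].

(** * Left coideal subalgebras and quantum homogeneous spaces *)

(* [coid_comul] is the coproduct of A restricted to B and corestricted to
   A (x) B.  It is determined by [coid_comulE], because A (x) B -> A (x) A is
   injective; the three axioms before it follow from the same fact. *)
Record coidealSubalg (K : fieldType) (A : hopfAlg K) := CoidealSubalg {
  coid_pred : {pred A};
  coid_sort :> subAlgType coid_pred;
  coid_comul : coid_sort -> atens A (@GRing.scale K coid_sort);
  coid_comulD : forall b c,
    coid_comul (b + c) = coid_comul b + coid_comul c;
  coid_comulZ : forall k b,
    coid_comul (k *: b) = tens_lact *:%R k (coid_comul b);
  coid_comulM : forall b c, coid_comul (b * c) =
    \sw_(b1, b2 <- coid_comul b) \sw_(c1, c2 <- coid_comul c)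
      apure A *:%R (b1 * c1) (b2 * c2);
  coid_comulE : forall b : coid_sort,
    \sw_(b1, b2 <- coid_comul b) apure A *:%R b1 (\val b2) = comul (\val b)
}.

Definition exact_at (L M N : zmodType) (u : L -> M) (v : M -> N) : Prop :=
  forall y, v y = 0 <-> exists x, u x = y.

Definition faithfully_flat_right (B : nzRingType) (M : zmodType)
    (ra : M -> B -> M) : Prop :=
  forall (X Y Z : lmodType B) (u : {linear X -> Y}) (v : {linear Y -> Z}),
    exact_at u v <->
    exact_at
      (fun t : tens ra (@GRing.scale B X) => \sw_(m, x <- t) tpure ra *:%R m (u x))
      (fun t : tens ra (@GRing.scale B Y) => \sw_(m, y <- t) tpure ra *:%R m (v y)).

Definition augmentation_ideal (K : fieldType) (A : hopfAlg K)
  (B : coidealSubalg A) (b : B) : Prop := counit (\val b) = 0.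

Definition quantum_homogeneous (K : fieldType) (A : hopfAlg K)
    (B : coidealSubalg A) : Prop :=
  faithfully_flat_right (fun (a : A) (b : B) => a * \val b) /\
  forall x : A,
    (exists s : seq (B * A), (forall p, p \in s -> augmentation_ideal p.1) /\
       x = \sum_(p <- s) \val p.1 * p.2)
    <->
    (exists s : seq (A * B), (forall p, p \in s -> augmentation_ideal p.2) /\
       x = \sum_(p <- s) p.1 * \val p.2).

(** * Relative Hopf modules *)

(* scalar multiplication by K on a left module over a K-algebra *)
Definition kscale {K : fieldType} {B : algType K} {V : lmodType B}
  (k : K) (v : V) : V := (k%:A : B) *: v.

Notation lcoact A V := (atens A (@kscale _ _ V)).

Definition relative_Hopf (K : fieldType) (A : hopfAlg K) (B : coidealSubalg A)
    (V : lmodType B) (delta : V -> lcoact A V) : Prop :=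
  left_coaction delta /\
  forall (b : B) v, delta (b *: v) =
    \sw_(b1, b2 <- coid_comul b) \sw_(a, w <- delta v)
      apure A kscale (b1 * a) (b2 *: w).

Definition finitely_generated (B : nzRingType) (V : lmodType B) : Prop :=
  exists n (g : 'I_n -> V), forall v, exists c : 'I_n -> B,
    v = \sum_i c i *: g i.

Record relHopfMod (K : fieldType) (A : hopfAlg K) (B : coidealSubalg A) :=
  RelHopfMod {
  rhm_sort :> lmodType B;
  coact : rhm_sort -> lcoact A rhm_sort;
  coactP : relative_Hopf coact;
  rhm_fg : finitely_generated rhm_sort
}.

(* a_(1) b S(a_(2)) as an element of B.  When B is a quantum homogeneous space
   it is the algebra of coinvariants of A -> A / B^+ A, so that this element of
   A does lie in B and the default value 0 is not used. *)
Definition adj (K : fieldType) (A : hopfAlg K) (B : coidealSubalg A)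
    (a : A) (b : B) : B :=
  insubd (0 : B) (\sw_(a1, a2 <- comul a) (a1 * \val b * antip a2)).

(* v b = v_(-2) b S(v_(-1)) v_(0), where v_(-2) (x) v_(-1) is the coproduct of
   the A-component of the coaction. *)
Definition ract0 (K : fieldType) (A : hopfAlg K) (B : coidealSubalg A)
    (V : lmodType B) (delta : V -> lcoact A V) (v : V) (b : B) : V :=
  \sw_(a, w <- delta v) (adj a b *: w).

(** * Differential calculi *)

Record bimodule (B : nzRingType) := Bimodule {
  bim_sort :> lmodType B;
  rscale : bim_sort -> B -> bim_sort;
  rscaleDl : forall v w b, rscale (v + w) b = rscale v b + rscale w b;
  rscaleDr : forall v b c, rscale v (b + c) = rscale v b + rscale v c;
  rscale1 : forall v, rscale v 1 = v;
  rscaleA : forall v b c, rscale v (b * c) = rscale (rscale v b) c;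
  rscaleC : forall b v c, rscale (b *: v) c = b *: rscale v c
}.

Record fodc (K : fieldType) (B : algType K) := Fodc {
  forms :> bimodule B;
  dif : B -> forms;
  difD : forall b c, dif (b + c) = dif b + dif c;
  difZ : forall (k : K) b, dif (k *: b) = kscale k (dif b);
  difM : forall b c, dif (b * c) = rscale (dif b) c + b *: dif c;
  dif_gen : forall w, exists s : seq (B * B), w = \sum_(p <- s) p.1 *: dif p.2
}.

Definition covariant_calculus (K : fieldType) (A : hopfAlg K)
    (B : coidealSubalg A) (Om : fodc B) (delta : Om -> lcoact A Om) : Prop :=
  left_coaction delta /\
  forall b c : B, delta (b *: dif Om c) =
    \sw_(b1, b2 <- coid_comul b) \sw_(c1, c2 <- coid_comul c)
      apure A kscale (b1 * c1) (b2 *: dif Om c2).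

(** * Connections *)

Section Connections.
Variables (K : fieldType) (A : hopfAlg K) (B : coidealSubalg A).
Variables (Om : fodc B) (deltaOm : Om -> lcoact A Om) (F : relHopfMod B).

Let rF : F -> B -> F := ract0 (@coact _ _ _ F).

(* Omega (x)_B F and F (x)_B Omega *)
Definition OmF := tens (@rscale B Om) (@GRing.scale B F).
Definition FOm := tens rF (@GRing.scale B Om).

HB.instance Definition _ := GRing.Zmodule.on OmF.
HB.instance Definition _ := GRing.Zmodule.on FOm.

Definition omf (w : Om) (f : F) : OmF := tpure (@rscale B Om) *:%R w f.
Definition fom (f : F) (w : Om) : FOm := tpure rF *:%R f w.

Definition OmF_l (b : B) (t : OmF) : OmF := tens_lact *:%R b t.
Definition OmF_r (t : OmF) (b : B) : OmF := tens_ract rF t b.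
Definition FOm_l (b : B) (t : FOm) : FOm := tens_lact *:%R b t.
Definition FOm_r (t : FOm) (b : B) : FOm := tens_ract (@rscale B Om) t b.

Definition OmF_k (k : K) (t : OmF) : OmF := tens_lact kscale k t.

Definition OmF_coact (t : OmF) : atens A OmF_k :=
  \sw_(w, f <- t) \sw_(a, w' <- deltaOm w) \sw_(c, f' <- coact f)
    apure A OmF_k (a * c) (omf w' f').

Definition connection (nabla : F -> OmF) : Prop :=
  [/\ forall f g, nabla (f + g) = nabla f + nabla g,
      forall (k : K) f, nabla (kscale k f) = OmF_k k (nabla f)
    & forall b f, nabla (b *: f) = omf (dif Om b) f + OmF_l b (nabla f)].

Definition covariant_connection (nabla : F -> OmF) : Prop :=
  forall f, OmF_coact (nabla f) =
    \sw_(a, g <- coact f) apure A OmF_k a (nabla g).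

Definition bimodule_map_of (nabla : F -> OmF) (sigma : FOm -> OmF) : Prop :=
  [/\ forall s t, sigma (s + t) = sigma s + sigma t,
      forall b t, sigma (FOm_l b t) = OmF_l b (sigma t),
      forall t b, sigma (FOm_r t b) = OmF_r (sigma t) b
    & forall f b,
        nabla (rF f b) = OmF_r (nabla f) b + sigma (fom f (dif Om b))].

End Connections.

(* Main.v *)
From HB Require Import structures.
Require Import Defs.
From mathcomp Require Import all_boot all_order all_algebra.
From mathcomp Require Import boolp reals complex.

Set Implicit Arguments.
Unset Strict Implicit.
Unset Printing Implicit Defensive.

Import GRing.Theory.
Local Open Scope ring_scope.

(** Write ad(a)(b) = a_(1) b S(a_(2)), so that f b = ad(f_(-1))(b) f_(0) in F and
  likewise in Omega.  The Leibniz rule expands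
    nabla(f b) = d(ad(f_(-1))(b)) (x) f_(0) + ad(f_(-1))(b) nabla(f_(0)),
  and the claim is that the second summand is nabla(f) b.  By covariance,
  f_(-1) (x) nabla(f_(0)) is the coaction of nabla(f); so the second summand is
  what one gets from nabla(f) by coacting and then acting through ad, and
  [OmF_coact_adj] identifies this with the right action of b on Omega (x)_B F.
  That identification is the action law ad(ac) = ad(a) ad(c) ([adjM]), which
  rests on the antimultiplicativity of the antipode ([antipM]) and on the fact
  that ad preserves B.

  That ad(a)(b) lies in B ([conj_val_in]) is the substantial point, and it uses
  both parts of the definition of a quantum homogeneous space.  From
  B^+ A = A B^+ it follows that x = ad(a)(b) satisfies 1 (x) x = x (x) 1 in
  A (x)_B A ([conj_val_coinvariant]): the translation map
  c |-> S(c_(1)) (x)_B c_(2) kills B^+ A, hence also A B^+.  From faithful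
  flatness it follows that such an x belongs to B
  ([faithfully_flat_descent]).

  Two bimodule maps agree once they agree on the elements f (x) db, because
  those generate F (x)_B Omega additively ([eq_bimodule_map]). *)

(** * Additive maps and Sweedler sums *)

Section AdditiveMaps.
Variables (G H : zmodType) (f : G -> H).
Hypothesis fD : {morph f : x y / x + y}.

Lemma morphD0 : f 0 = 0.
Proof. by apply: (@addrI _ (f 0)); rewrite -fD !addr0. Qed.

Lemma morphD_sum I (s : seq I) (E : I -> G) :
  f (\sum_(i <- s) E i) = \sum_(i <- s) f (E i).
Proof. exact: (big_morph f fD morphD0). Qed.

End AdditiveMaps.

Section TensorSums.
Variables (R : Type) (M N : zmodType) (ra : M -> R -> M) (la : R -> N -> N).
Implicit Types x y : tens ra la.

Lemma eq_tsum (G : zmodType) (beta gamma : M -> N -> G) x :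
  beta =2 gamma -> tsum beta x = tsum gamma x.
Proof. by move=> e; apply: eq_bigr => p _; rewrite e. Qed.

Lemma tsum0 (G : zmodType) (beta : M -> N -> G) :
  balanced ra la beta -> tsum beta (0 : tens ra la) = 0.
Proof. by move=> bal; apply: (morphD0 (f := tsum beta)) => x y; exact: tsumD. Qed.

Lemma tsum_sum (G : zmodType) (beta : M -> N -> G) I (s : seq I)
    (E : I -> tens ra la) :
  balanced ra la beta ->
  tsum beta (\sum_(i <- s) E i) = \sum_(i <- s) tsum beta (E i).
Proof.
by move=> bal; apply: (morphD_sum (f := tsum beta)) => x y; exact: tsumD.
Qed.

(** Since [tsum] is a sum over a representative, iterated Sweedler sums commute
  and factor like ordinary finite sums; balancedness is needed only where, as
  here, a sum is evaluated on a tensor that is itself given as a sum. *)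
Lemma tsum_tsum (R' : Type) (M' N' : zmodType) (ra' : M' -> R' -> M')
    (la' : R' -> N' -> N') (G : zmodType) (beta : M -> N -> G)
    (E : M' -> N' -> tens ra la) (x : tens ra' la') :
  balanced ra la beta ->
  tsum beta (tsum E x) = \sw_(m, n <- x) tsum beta (E m n).
Proof. exact: tsum_sum. Qed.

Lemma tsum_split (G : zmodType) (beta gamma : M -> N -> G) x :
  \sw_(m, n <- x) (beta m n + gamma m n) = tsum beta x + tsum gamma x.
Proof. exact: big_split. Qed.

Lemma mulr_tsuml (G : nzRingType) (c : G) (beta : M -> N -> G) x :
  tsum beta x * c = \sw_(m, n <- x) (beta m n * c).
Proof. exact: mulr_suml. Qed.

Lemma mulr_tsumr (G : nzRingType) (c : G) (beta : M -> N -> G) x :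
  c * tsum beta x = \sw_(m, n <- x) (c * beta m n).
Proof. exact: mulr_sumr. Qed.

Lemma exchange_tsum (R' : Type) (M' N' : zmodType) (ra' : M' -> R' -> M')
    (la' : R' -> N' -> N') (G : zmodType) (E : M -> N -> M' -> N' -> G)
    x (y : tens ra' la') :
  \sw_(m, n <- x) \sw_(m', n' <- y) E m n m' n' =
  \sw_(m', n' <- y) \sw_(m, n <- x) E m n m' n'.
Proof. exact: exchange_big. Qed.

Lemma tpureDl m m' n : tpure ra la (m + m') n = tpure ra la m n + tpure ra la m' n.
Proof. by case: (tpure_balanced ra la). Qed.

Lemma tpureDr m n n' : tpure ra la m (n + n') = tpure ra la m n + tpure ra la m n'.
Proof. by case: (tpure_balanced ra la). Qed.

Lemma tpure_bal m r n : tpure ra la (ra m r) n = tpure ra la m (la r n).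
Proof. by case: (tpure_balanced ra la). Qed.

Lemma tpure_suml I (s : seq I) (E : I -> M) n :
  tpure ra la (\sum_(i <- s) E i) n = \sum_(i <- s) tpure ra la (E i) n.
Proof.
by apply: (morphD_sum (f := fun m => tpure ra la m n)) => m m'; exact: tpureDl.
Qed.

Lemma tpure_sumr I (s : seq I) (E : I -> N) m :
  tpure ra la m (\sum_(i <- s) E i) = \sum_(i <- s) tpure ra la m (E i).
Proof. by apply: (morphD_sum (f := tpure ra la m)) => n n'; exact: tpureDr. Qed.

Lemma tpure_tsuml (R' : Type) (M' N' : zmodType) (ra' : M' -> R' -> M')
    (la' : R' -> N' -> N') (E : M' -> N' -> M) (x : tens ra' la') n :
  tpure ra la (tsum E x) n = \sw_(m, n' <- x) tpure ra la (E m n') n.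
Proof. exact: tpure_suml. Qed.

Lemma tpure_tsumr (R' : Type) (M' N' : zmodType) (ra' : M' -> R' -> M')
    (la' : R' -> N' -> N') (E : M' -> N' -> N) (x : tens ra' la') m :
  tpure ra la m (tsum E x) = \sw_(m', n <- x) tpure ra la m (E m' n).
Proof. exact: tpure_sumr. Qed.

Lemma tsum_lact R' (act : R' -> M -> M) r (G : zmodType) (beta : M -> N -> G) x :
  balanced ra la beta ->
  tsum beta (tens_lact act r x) = \sw_(m, n <- x) beta (act r m) n.
Proof.
by move=> bal; rewrite tsum_tsum //; apply: eq_tsum => m n; rewrite tsum_pure.
Qed.

End TensorSums.

(** * Hopf algebras: coassociativity and the antipode *)

Section HopfAlgebra.
Variables (K : fieldType) (A : hopfAlg K).
Implicit Types (a c x y : A) (k : K).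

Notation bilin := (balanced (fun (a : A) (k : K) => k *: a) *:%R).

Lemma comul_tsumD (G : zmodType) (beta : A -> A -> G) x y :
  bilin beta ->
  tsum beta (comul (x + y)) = tsum beta (comul x) + tsum beta (comul y).
Proof. by move=> bal; rewrite comulD tsumD. Qed.

Lemma comul_tsumZ (G : zmodType) (beta : A -> A -> G) k x :
  bilin beta ->
  tsum beta (comul (k *: x)) = \sw_(x1, x2 <- comul x) beta (k *: x1) x2.
Proof. by move=> bal; rewrite comulZ tsum_lact. Qed.

Lemma comul_tsumM (G : zmodType) (beta : A -> A -> G) x y :
  bilin beta ->
  tsum beta (comul (x * y)) =
  \sw_(x1, x2 <- comul x) \sw_(y1, y2 <- comul y) beta (x1 * y1) (x2 * y2).
Proof.
move=> bal; rewrite comulM tsum_tsum //; apply: eq_tsum => x1 x2.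
by rewrite tsum_tsum //; apply: eq_tsum => y1 y2; rewrite tsum_pure.
Qed.

Definition trilinear (G : zmodType) (h : A -> A -> A -> G) : Prop :=
  [/\ forall a a' b c, h (a + a') b c = h a b c + h a' b c,
      forall a b b' c, h a (b + b') c = h a b c + h a b' c,
      forall a b c c', h a b (c + c') = h a b c + h a b c',
      forall k a b c, h (k *: a) b c = h a (k *: b) c
    & forall k a b c, h a (k *: b) c = h a b (k *: c)].

(** In Sweedler notation both sides are h(x_(1), x_(2), x_(3)): a trilinear h
  factors through A (x) A (x) A, where the coassociativity axiom lives. *)
Lemma comul_coassoc (G : zmodType) (h : A -> A -> A -> G) x :
  trilinear h ->
  \sw_(x1, x2 <- comul x) \sw_(y1, y2 <- comul x1) h y1 y2 x2 =
  \sw_(x1, x2 <- comul x) \sw_(y1, y2 <- comul x2) h x1 y1 y2.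
Proof.
case=> D1 D2 D3 Z1 Z2.
have bal a : bilin (h a) by split=> *; rewrite ?D2 ?D3 ?Z2.
pose H (a : A) (t : atens A (@GRing.scale K A)) := tsum (h a) t.
have Hb : balanced (fun (a : A) (k : K) => k *: a)
    (tens_lact (ra := fun (a : A) (k : K) => k *: a) (la := *:%R) *:%R) H.
  split=> [a a' t|a t t'|a k t].
  - by rewrite /H -tsum_split; apply: eq_tsum.
  - exact: tsumD.
  - by rewrite /H tsum_lact //; apply: eq_tsum => b c; rewrite Z1.
have /(congr1 (tsum H)) := comulA x; rewrite !tsum_tsum //.
rewrite (_ : tsum _ _ = \sw_(x1, x2 <- comul x) \sw_(y1, y2 <- comul x1) h y1 y2 x2).
  move=> ->; apply: eq_tsum => x1 x2; exact: tsum_pure.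
apply: eq_tsum => x1 x2; rewrite tsum_tsum //; apply: eq_tsum => y1 y2.
by rewrite tsum_pure // /H tsum_pure.
Qed.

Lemma scale_counitl (G : zmodType) (f : A -> G) x :
  (forall a c, f (a + c) = f a + f c) ->
  \sw_(x1, x2 <- comul x) f (counit x1 *: x2) = f x.
Proof.
by move=> fD; rewrite -{2}[x]counitl; symmetry; exact: morphD_sum fD _ _ _.
Qed.

Lemma scale_counitr (G : zmodType) (f : A -> G) x :
  (forall a c, f (a + c) = f a + f c) ->
  \sw_(x1, x2 <- comul x) f (counit x2 *: x1) = f x.
Proof.
by move=> fD; rewrite -{2}[x]counitr; symmetry; exact: morphD_sum fD _ _ _.
Qed.

(** Both S(xy) and S(y) S(x) are convolution inverses of the product
  A (x) A -> A.  Hence both are the values of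
  S(x_(1) y_(1)) x_(2) y_(2) S(y_(3)) S(x_(3)), according to whether the last
  four factors or the first three are contracted. *)
Lemma antipM x y : antip (x * y) = antip y * antip x.
Proof.
pose E (p q r s t u : A) : A := antip (p * s) * (q * t) * (antip u * antip r).
have Ex s t u : trilinear (fun p q r => E p q r s t u).
  split=> *; rewrite /E ?(mulrDl, mulrDr, antipD, antipZ) //;
    by rewrite -?(scalerAl, scalerAr) ?antipZ -?(scalerAl, scalerAr).
have Ey p q r : trilinear (fun s t u => E p q r s t u).
  split=> *; rewrite /E ?(mulrDl, mulrDr, antipD, antipZ) //;
    by rewrite -?(scalerAl, scalerAr) ?antipZ -?(scalerAl, scalerAr).
(* contract x_(2) y_(2) S(y_(3)) S(x_(3)) *)
transitivity (\sw_(x1, x2 <- comul x) \sw_(q, r <- comul x2)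
  \sw_(y1, y2 <- comul y) \sw_(t, u <- comul y2) E x1 q r y1 t u).
  rewrite -[LHS](scale_counitr (f := fun z => antip (z * y))); last first.
    by move=> a c; rewrite mulrDl antipD.
  apply: eq_tsum => x1 x2; rewrite -scalerAl antipZ.
  rewrite -[in LHS](scale_counitr (f := fun z => antip (x1 * z))); last first.
    by move=> a c; rewrite mulrDr antipD.
  rewrite exchange_tsum.
  rewrite -mulr_algr mulr_tsuml; apply: eq_tsum => y1 y2.
  rewrite -antipr mulr_tsumr; apply: eq_tsum => q r.
  transitivity (antip (x1 * y1) * (q * (counit y2)%:A * antip r)).
    by rewrite mulr_algr -[x1 * _]scalerAr antipZ -!scalerAl -scalerAr.
  rewrite -antipr mulr_tsumr mulr_tsuml mulr_tsumr; apply: eq_tsum => t u.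
  by rewrite /E !mulrA.
(* contract S(x_(1) y_(1)) x_(2) y_(2) *)
transitivity (\sw_(x1, x2 <- comul x) \sw_(p, q <- comul x1)
  \sw_(y1, y2 <- comul y) \sw_(s, t <- comul y1) E p q x2 s t y2); last first.
  rewrite -[RHS](scale_counitl (f := fun z => antip y * antip z)); last first.
    by move=> a c; rewrite antipD mulrDr.
  apply: eq_tsum => x1 x2.
  rewrite antipZ -scalerAr exchange_tsum.
  rewrite -[in RHS](scale_counitl (f := fun z => antip z * antip x2)); last first.
    by move=> a c; rewrite antipD mulrDl.
  rewrite -mulr_algl mulr_tsumr; apply: eq_tsum => y1 y2.
  rewrite mulr_algl antipZ -scalerAl scalerA -counitM -mulr_algl -antipl.
  rewrite comul_tsumM.
    by rewrite mulr_tsuml; apply: eq_tsum => ? ?; rewrite mulr_tsuml.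
  split=> *; rewrite ?(mulrDl, mulrDr, antipD, antipZ) //.
  by rewrite -scalerAl -scalerAr.
(* the two bracketings agree: coassociativity in x, then in y *)
transitivity (\sw_(y1, y2 <- comul y) \sw_(t, u <- comul y2)
   \sw_(x1, x2 <- comul x) \sw_(p, q <- comul x1) E p q x2 y1 t u).
  transitivity (\sw_(y1, y2 <- comul y) \sw_(t, u <- comul y2)
    \sw_(x1, x2 <- comul x) \sw_(q, r <- comul x2) E x1 q r y1 t u).
    under eq_tsum => x1 x2 do rewrite exchange_tsum.
    rewrite exchange_tsum; apply: eq_tsum => y1 y2.
    under eq_tsum => x1 x2 do rewrite exchange_tsum.
    by rewrite exchange_tsum.
  by apply: eq_tsum => y1 y2; apply: eq_tsum => t u; rewrite comul_coassoc.
transitivity (\sw_(x1, x2 <- comul x) \sw_(p, q <- comul x1)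
  \sw_(y1, y2 <- comul y) \sw_(t, u <- comul y2) E p q x2 y1 t u).
  under eq_tsum => y1 y2 do rewrite exchange_tsum.
  rewrite exchange_tsum; apply: eq_tsum => x1 x2.
  under eq_tsum => y1 y2 do rewrite exchange_tsum.
  by rewrite exchange_tsum.
by apply: eq_tsum => x1 x2; apply: eq_tsum => p q; rewrite comul_coassoc.
Qed.

End HopfAlgebra.

(** * Faithfully flat descent from A to B *)

Section Descent.
Variables (K : fieldType) (A : hopfAlg K) (B : coidealSubalg A).
Implicit Types (a c : A) (b : B).

(** A copy of A carrying the left B-module structure; the argument makes B
  recoverable from the type, so that the structure can be inferred. *)
Definition left_module_of (B' : coidealSubalg A) : Type := A.

HB.instance Definition _ (B' : coidealSubalg A) :=
  GRing.Zmodule.copy (left_module_of B') A.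

Notation leftB := (left_module_of B).

Definition leftB_scale b (c : leftB) : leftB := \val b * (c : A).

Fact leftB_scaleA b b' (c : leftB) :
  leftB_scale b (leftB_scale b' c) = leftB_scale (b * b') c.
Proof. by rewrite /leftB_scale rmorphM mulrA. Qed.

Fact leftB_scale1 : left_id 1 leftB_scale.
Proof. by move=> c; rewrite /leftB_scale rmorph1 mul1r. Qed.

Fact leftB_scaleDr : right_distributive leftB_scale +%R.
Proof. by move=> b c c'; exact: mulrDr. Qed.

Fact leftB_scaleDl c : {morph leftB_scale^~ c : b b' / b + b'}.
Proof. by move=> b b'; rewrite /leftB_scale rmorphD; exact: mulrDl. Qed.

HB.instance Definition _ := GRing.Zmodule_isLmodule.Build B leftB
  leftB_scaleA leftB_scale1 leftB_scaleDr leftB_scaleDl.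

Notation rmulB := (fun (a : A) (b : B) => a * \val b).

Definition tensAA := tens rmulB (@GRing.scale B leftB).

HB.instance Definition _ := GRing.Zmodule.on tensAA.

Definition tAA a c : tensAA := tpure rmulB (@GRing.scale B leftB) a c.

Lemma tAA_bal a b c : tAA (a * \val b) c = tAA a (\val b * c).
Proof. exact: tpure_bal. Qed.

Lemma tAA_val b c : tAA (\val b) c = tAA 1 (\val b * c).
Proof. by rewrite -tAA_bal mul1r. Qed.

Lemma tAADl a a' c : tAA (a + a') c = tAA a c + tAA a' c.
Proof. exact: tpureDl. Qed.

Lemma tAADr a c c' : tAA a (c + c') = tAA a c + tAA a c'.
Proof. exact: tpureDr. Qed.

(** The tensor product over B is balanced over the ground field, because B
  contains the scalars. *)
Lemma tAAZ (k : K) a c : tAA (k *: a) c = tAA a (k *: c).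
Proof.
have kE : \val (k%:A : B) = k%:A by rewrite linearZ /= rmorph1.
by have := tAA_bal a k%:A c; rewrite kE mulr_algr mulr_algl.
Qed.

Definition tensAA_lmul a (t : tensAA) : tensAA := tens_lact *%R a t.

Lemma tensAA_lmul_balanced a :
  balanced rmulB (@GRing.scale B leftB) (fun m n => tAA (a * m) n).
Proof.
split=> [m m' n|m n n'|m b n]; first by rewrite mulrDr tAADl.
  exact: tAADr.
by rewrite mulrA tAA_bal.
Qed.

Lemma tensAA_lmul_pure a m n : tensAA_lmul a (tAA m n) = tAA (a * m) n.
Proof. exact: tsum_pure (tensAA_lmul_balanced a). Qed.

Lemma tensAA_lmulDr a (s t : tensAA) :
  tensAA_lmul a (s + t) = tensAA_lmul a s + tensAA_lmul a t.
Proof. exact: tsumD (tensAA_lmul_balanced a). Qed.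

Lemma tensAA_lmulDl a a' (t : tensAA) :
  tensAA_lmul (a + a') t = tensAA_lmul a t + tensAA_lmul a' t.
Proof.
rewrite /tensAA_lmul /tens_lact -tsum_split; apply: eq_tsum => m n.
by rewrite mulrDl tpureDl.
Qed.

Lemma tensAA_lmulA a a' (t : tensAA) :
  tensAA_lmul a (tensAA_lmul a' t) = tensAA_lmul (a * a') t.
Proof.
rewrite {2}/tensAA_lmul /tens_lact [LHS](tsum_tsum _ _ (tensAA_lmul_balanced a)).
by apply: eq_tsum => m n; rewrite (tsum_pure _ _ (tensAA_lmul_balanced a)) mulrA.
Qed.

Lemma tensAA_lmul1 (t : tensAA) : tensAA_lmul 1 t = t.
Proof.
rewrite [RHS](@tens_pureE _ _ _ rmulB (@GRing.scale B leftB)).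
by apply: eq_bigr => p _; rewrite mul1r.
Qed.

Definition tensAA_scale b t := tensAA_lmul (\val b) t.

Fact tensAA_scaleA b b' t :
  tensAA_scale b (tensAA_scale b' t) = tensAA_scale (b * b') t.
Proof. by rewrite /tensAA_scale tensAA_lmulA rmorphM. Qed.

Fact tensAA_scale1 : left_id 1 tensAA_scale.
Proof. by move=> t; rewrite /tensAA_scale rmorph1 tensAA_lmul1. Qed.

Fact tensAA_scaleDr : right_distributive tensAA_scale +%R.
Proof. by move=> b s t; exact: tensAA_lmulDr. Qed.

Fact tensAA_scaleDl t : {morph tensAA_scale^~ t : b b' / b + b'}.
Proof. by move=> b b'; rewrite /tensAA_scale rmorphD; exact: tensAA_lmulDl. Qed.

HB.instance Definition _ := GRing.Zmodule_isLmodule.Build B tensAA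
  tensAA_scaleA tensAA_scale1 tensAA_scaleDr tensAA_scaleDl.

Definition inclB (b : B^o) : leftB := \val b.

Fact inclB_linear : linear inclB.
Proof.
move=> b c d; rewrite /inclB -[b *: c]/(b * c).
by rewrite (rmorphD (\val : B -> A)) (rmorphM (\val : B -> A)).
Qed.

HB.instance Definition _ := GRing.isLinear.Build B B^o leftB _ inclB inclB_linear.

Definition descent_diff (c : leftB) : tensAA := tAA c 1 - tAA 1 c.

Fact descent_diff_linear : linear descent_diff.
Proof.
move=> b c d; rewrite /descent_diff tAADl tAADr scalerBr.
rewrite -[b *: tAA c 1]/(tensAA_lmul _ _) -[b *: tAA 1 c]/(tensAA_lmul _ _).
rewrite !tensAA_lmul_pure !mulr1 (tAA_val b c).
by rewrite opprD addrACA.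
Qed.

HB.instance Definition _ :=
  GRing.isLinear.Build B leftB tensAA _ descent_diff descent_diff_linear.

(** B is the equaliser of the two maps A -> A (x)_B A.  After tensoring with A on
  the left the sequence becomes exact for a trivial reason: if the image of
  sum a (x) c vanishes, then multiplying its first two tensor factors gives
  sum a (x) c = sum ac (x) 1.  Faithful flatness then gives the exactness of the
  original sequence. *)
Lemma faithfully_flat_descent :
  faithfully_flat_right rmulB -> exact_at inclB descent_diff.
Proof.
move=> ff; apply/ff => y.
pose mulT (a : A) (t : tensAA) := tensAA_lmul a t.
have mulT_bal : balanced rmulB (@GRing.scale B tensAA) mulT.
  split=> [a a' t|a t t'|a b t]; first exact: tensAA_lmulDl.
    exact: tensAA_lmulDr.
  by rewrite /mulT -tensAA_lmulA.
pose proj (a : A) (c : leftB) : tensAA := tAA (a * c) 1.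
have proj_bal : balanced rmulB (@GRing.scale B leftB) proj.
  split=> [a a' c|a c c'|a b c]; rewrite /proj.
  - by rewrite mulrDl tAADl.
  - by rewrite -tAADl -mulrDr.
  - by rewrite -mulrA.
split=> [y0|[t <-]].
- exists (tsum (fun (a : A) (c : A) => tpure rmulB (@GRing.scale B B^o) (a * c) 1) y).
  have incl_bal : balanced rmulB (@GRing.scale B B^o)
      (fun m x => tpure rmulB (@GRing.scale B leftB) m (inclB x)).
    split=> [m m' x|m x x'|m r x]; first exact: tpureDl.
      by rewrite raddfD tpureDr.
    by rewrite tpure_bal linearZ.
  rewrite [LHS]tsum_tsum //.
  transitivity (tsum proj y).
    apply: eq_tsum => a c; rewrite tsum_pure // /inclB.
    by rewrite (rmorph1 (\val : B -> A)).
  have /(congr1 (tsum mulT)) := y0; rewrite tsum0 // tsum_tsum // => e.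
  have : \sw_(a, c <- y) (proj a c - tAA a c) = 0.
    rewrite -[RHS]e; apply: eq_tsum => a c; rewrite tsum_pure //.
    rewrite /mulT /descent_diff /= tensAA_lmulDr.
    have lmulN u : tensAA_lmul a (- u) = - tensAA_lmul a u.
      apply: (addrI (tensAA_lmul a u)).
      by rewrite -tensAA_lmulDr !subrr (morphD0 (tensAA_lmulDr a)).
    by rewrite lmulN !tensAA_lmul_pure mulr1.
  rewrite [tsum _ _]big_split /= -[\sum_(p <- _) proj _ _]/(tsum proj y) sumrN.
  rewrite /tAA -tens_pureE => /eqP; rewrite subr_eq0 => /eqP; exact.
- have diff_bal : balanced rmulB (@GRing.scale B leftB)
      (fun m x => tpure rmulB (@GRing.scale B tensAA) m (descent_diff x)).
    split=> [m m' x|m x x'|m r x]; first exact: tpureDl.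
      by rewrite raddfD tpureDr.
    by rewrite tpure_bal linearZ.
  rewrite [LHS]tsum_tsum //; apply: big1 => p _; rewrite tsum_pure //.
  rewrite /= /descent_diff /inclB tAA_val mulr1 subrr.
  apply: (morphD0 (f := tpure rmulB (@GRing.scale B tensAA) p.1)) => u v.
  exact: tpureDr.
Qed.

(** * The adjoint action of A on B *)

Notation bilin := (balanced (fun (a : A) (k : K) => k *: a) *:%R).

Lemma coid_comul_tsum (G : zmodType) (beta : A -> A -> G) b :
  bilin beta ->
  tsum beta (comul (\val b)) = \sw_(b1, b2 <- coid_comul b) beta b1 (\val b2).
Proof.
move=> bal; rewrite -coid_comulE tsum_tsum //.
by apply: eq_tsum => b1 b2; rewrite tsum_pure.
Qed.

Lemma coid_counitr b :
  \sw_(b1, b2 <- coid_comul b) (counit (\val b2) *: b1) = \val b.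
Proof.
rewrite -[RHS]counitr; symmetry.
apply: (coid_comul_tsum (beta := fun x1 x2 => counit x2 *: x1)).
split=> *; rewrite ?scalerDr ?counitD ?scalerDl //.
by rewrite counitZ scalerA mulrC.
Qed.

(** l . (S(c_(1)) (x)_B c_(2)) . r, for the A-bimodule structure of A (x)_B A.
  For r = 1 this is the inverse of the Galois map
  A (x)_B A -> A (x) A/(B^+ A), evaluated at the class of l (x) c. *)
Definition kappa l c r : tensAA :=
  \sw_(c1, c2 <- comul c) tAA (l * antip c1) (c2 * r).

Lemma kappa_bilin l r : bilin (fun c1 c2 => tAA (l * antip c1) (c2 * r)).
Proof.
split=> [m m' n|m n n'|m k n]; first by rewrite antipD mulrDr tAADl.
  by rewrite mulrDl tAADr.
by rewrite antipZ -scalerAr tAAZ scalerAl.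
Qed.

Lemma kappaD l c c' r : kappa l (c + c') r = kappa l c r + kappa l c' r.
Proof. exact: comul_tsumD (kappa_bilin l r). Qed.

Lemma kappaZ l k c r : kappa l (k *: c) r = kappa (k *: l) c r.
Proof.
rewrite /kappa comul_tsumZ; last exact: kappa_bilin.
by apply: eq_tsum => c1 c2; rewrite antipZ -scalerAr scalerAl.
Qed.

(** S(b_(1) c_(1)) (x) b_(2) c_(2) = S(c_(1)) S(b_(1)) b_(2) (x) c_(2), because
  b_(2) lies in B and can be moved across the tensor sign. *)
Lemma kappa_mull l b c r :
  kappa l (\val b * c) r = kappa l (counit (\val b) *: c) r.
Proof.
rewrite kappaZ /kappa comul_tsumM; last exact: kappa_bilin.
rewrite coid_comul_tsum; last first.
  split=> [m m' n|m n n'|m k n].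
  - rewrite -tsum_split; apply: eq_tsum => c1 c2.
    by rewrite mulrDl antipD mulrDr tAADl.
  - by rewrite -tsum_split; apply: eq_tsum => c1 c2; rewrite !mulrDl tAADr.
  - apply: eq_tsum => c1 c2.
    by rewrite -scalerAl antipZ -scalerAr tAAZ !scalerAl.
rewrite exchange_tsum; apply: eq_tsum => c1 c2.
transitivity (\sw_(b1, b2 <- coid_comul b)
    tAA (l * antip c1 * (antip b1 * \val b2)) (c2 * r)).
  by apply: eq_tsum => b1 b2; rewrite antipM !mulrA tAA_bal !mulrA.
rewrite -[LHS]tpure_tsuml -mulr_tsumr.
have <- : \sw_(b1, b2 <- comul (\val b)) (antip b1 * b2) =
    \sw_(b1, b2 <- coid_comul b) (antip b1 * \val b2).
  apply: coid_comul_tsum; split=> *; rewrite ?(antipD, mulrDl, mulrDr) //.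
  by rewrite antipZ -scalerAl scalerAr.
by rewrite antipl mulr_algr scalerAl.
Qed.

(** [kappa_mull] says that kappa vanishes on B^+ A, which is equal to A B^+. *)
Lemma kappa_mulr (B_qhs : quantum_homogeneous B) l b c r :
  kappa l (c * \val b) r = kappa l (counit (\val b) *: c) r.
Proof.
have kD : {morph (fun x => kappa l x r) : x y / x + y} by move=> x y; exact: kappaD.
pose b0 := b - (counit (\val b))%:A.
have b0E : \val b0 = \val b - (counit (\val b))%:A.
  by rewrite rmorphB /= linearZ /= rmorph1.
have -> : c * \val b = c * \val b0 + counit (\val b) *: c.
  by rewrite b0E mulrBr mulr_algr subrK.
rewrite kappaD [X in X + _](_ : _ = 0) ?add0r //.
have [_ /(_ (c * \val b0))[_]] := B_qhs.
case=> [|s [sB ->]].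
  exists [:: (c, b0)]; split; last by rewrite big_seq1.
  move=> p; rewrite inE => /eqP -> /=.
  rewrite /augmentation_ideal b0E -scaleN1r counitD !counitZ counit1 mulr1.
  by rewrite mulN1r subrr.
rewrite (morphD_sum kD) /= big_seq; apply: big1 => p /sB pB.
by rewrite kappa_mull pB scale0r (morphD0 kD).
Qed.

Lemma tAA_kappa c r : tAA 1 (c * r) = \sw_(c1, c2 <- comul c) kappa c1 c2 r.
Proof.
rewrite -(comul_coassoc (h := fun p q s => tAA (p * antip q) (s * r))); last first.
  split=> *; rewrite ?(antipD, antipZ, mulrDl, mulrDr, tAADl, tAADr) //.
    by rewrite -scalerAl -scalerAr.
  by rewrite -scalerAr tAAZ scalerAl.
rewrite -(scale_counitl (f := fun z => tAA 1 (z * r))); last first.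
  by move=> a a'; rewrite mulrDl tAADr.
apply: eq_tsum => c1 c2; rewrite -[RHS]tpure_tsuml antipr -scalerAl.
by rewrite -tAAZ.
Qed.

(** The element of A that [adj a b] stands for, before it is known to lie in
  B. *)
Definition conj_val a b : A := \sw_(a1, a2 <- comul a) (a1 * \val b * antip a2).

(** Since 1 (x) c = c_(1) kappa(c_(2)), taking c = a_(1) b gives
  1 (x) a_(1) b S(a_(2)) = a_(1) b_(1) kappa(a_(2) b_(2)) S(a_(3))
                         = a_(1) b kappa(a_(2)) S(a_(3)),
  where kappa(c) = S(c_(1)) (x) c_(2), and kappa(a_(1)) S(a_(2)) = S(a) (x) 1. *)
Lemma conj_val_coinvariant (B_qhs : quantum_homogeneous B) a b :
  tAA 1 (conj_val a b) = tAA (conj_val a b) 1.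
Proof.
rewrite [LHS]tpure_tsumr [RHS]tpure_tsuml.
transitivity (\sw_(a1, a2 <- comul a) \sw_(p, q <- comul a1)
    kappa (p * \val b) q (antip a2)).
  apply: eq_tsum => a1 a2; rewrite [LHS]tAA_kappa.
  have kbil : bilin (fun p q => kappa p q (antip a2)).
    split=> [m m' n|m n n'|m k n]; last by rewrite kappaZ.
      rewrite /kappa -tsum_split; apply: eq_tsum => c1 c2.
      by rewrite mulrDl tAADl.
    exact: kappaD.
  rewrite comul_tsumM //; apply: eq_tsum => p q.
  rewrite coid_comul_tsum; last first.
    split=> [m m' n|m n n'|m k n].
    - by rewrite mulrDr; case: kbil => ->.
    - by rewrite mulrDr; case: kbil => _ ->.
    - by rewrite -!scalerAr; case: kbil => _ _ <-.
  rewrite -[in RHS](coid_counitr b) mulr_tsumr.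
  have kD : {morph (fun x => kappa x q (antip a2)) : x y / x + y}.
    by move=> x y; case: kbil => ->.
  rewrite [RHS](morphD_sum kD).
  by apply: eq_bigr => bb _; rewrite kappa_mulr // kappaZ scalerAr.
rewrite comul_coassoc; last first.
  split=> *; rewrite ?(antipD, mulrDl, kappaD) //.
  - rewrite /kappa -tsum_split; apply: eq_tsum => c1 c2.
    by rewrite !mulrDl tAADl.
  - rewrite /kappa -tsum_split; apply: eq_tsum => c1 c2.
    by rewrite mulrDr tAADr.
  - by rewrite kappaZ scalerAl.
  - rewrite kappaZ antipZ; apply: eq_tsum => c1 c2.
    by rewrite -scalerAl tAAZ !scalerAr.
apply: eq_tsum => a1 a2.
rewrite /kappa (comul_coassoc
  (h := fun s t r => tAA (a1 * \val b * antip s) (t * antip r))); last first.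
  split=> *; rewrite ?(antipD, antipZ, mulrDl, mulrDr, tAADl, tAADr) //.
    by rewrite -scalerAr tAAZ scalerAl.
  by rewrite -scalerAl scalerAr.
rewrite -[RHS](scale_counitr (f := fun z => tAA (a1 * \val b * antip z) 1)); last first.
  by move=> x y; rewrite antipD mulrDr tAADl.
apply: eq_tsum => s e; rewrite -[LHS]tpure_tsumr antipr.
by rewrite antipZ -scalerAr tAAZ.
Qed.

Lemma conj_val_in (B_qhs : quantum_homogeneous B) a b :
  conj_val a b \in coid_pred B.
Proof.
have [/faithfully_flat_descent ex _] := B_qhs.
have [] := (ex (conj_val a b)).1.
  by rewrite /= /descent_diff conj_val_coinvariant // subrr.
by move=> c <-; exact: valP.
Qed.

Lemma val_adj (B_qhs : quantum_homogeneous B) a b :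
  \val (adj a b) = conj_val a b.
Proof. by rewrite insubdK //; exact: conj_val_in. Qed.

Lemma conj_bilin x : bilin (fun a1 a2 => a1 * x * antip a2).
Proof.
split=> *; rewrite ?(antipD, antipZ, mulrDl, mulrDr) //.
by rewrite -scalerAr -!scalerAl.
Qed.

Lemma adjDl (B_qhs : quantum_homogeneous B) a a' b :
  adj (a + a') b = adj a b + adj a' b.
Proof.
apply: val_inj; rewrite rmorphD /= !val_adj //.
exact: comul_tsumD (conj_bilin _).
Qed.

Lemma adjZl (B_qhs : quantum_homogeneous B) k a b :
  adj (k *: a) b = k *: adj a b.
Proof.
apply: val_inj; rewrite linearZ /= !val_adj // /conj_val.
rewrite comul_tsumZ; last exact: conj_bilin.
rewrite -mulr_algl mulr_tsumr; apply: eq_tsum => a1 a2.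
by rewrite mulr_algl !scalerAl.
Qed.

(** By antimultiplicativity of S both sides are
  a_(1) c_(1) b S(c_(2)) S(a_(2)).  On the right the outer action receives
  c_(1) b S(c_(2)) only because that element lies in B. *)
Lemma adjM (B_qhs : quantum_homogeneous B) a c b :
  adj (a * c) b = adj a (adj c b).
Proof.
apply: val_inj; rewrite !val_adj // /conj_val val_adj //.
rewrite comul_tsumM; last exact: conj_bilin.
apply: eq_tsum => a1 a2; rewrite mulr_tsumr mulr_tsuml.
by apply: eq_tsum => c1 c2; rewrite antipM !mulrA.
Qed.

End Descent.

(** * Bimodule maps of covariant connections *)

Section BimoduleMap.
Variables (K : fieldType) (A : hopfAlg K) (B : coidealSubalg A).
Variables (Om : fodc B) (deltaOm : Om -> lcoact A Om) (F : relHopfMod B).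
Hypothesis B_qhs : quantum_homogeneous B.
Hypothesis Om_mod0 : forall (w : Om) (b : B), rscale w b = ract0 deltaOm w b.

Lemma OmF_l_balanced (b : B) :
  balanced (@rscale B Om) (@GRing.scale B F) (fun w f => omf (b *: w) f).
Proof.
split=> [w w' f|w f f'|w c f]; rewrite ?scalerDr ?tpureDl //.
- exact: tpureDl.
- exact: tpureDr.
- by rewrite -rscaleC; exact: tpure_bal.
Qed.

Lemma OmF_l_pure (b : B) (w : Om) (f : F) :
  OmF_l b (omf w f) = omf (b *: w) f.
Proof. exact: tsum_pure (OmF_l_balanced b). Qed.

Lemma OmF_l_adj_balanced (b : B) :
  balanced (fun (a : A) (k : K) => k *: a) (@OmF_k _ _ _ Om F)
    (fun a t => OmF_l (adj a b) t).
Proof.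
split=> [a a' t|a s t|a k t].
- rewrite adjDl // /OmF_l /tens_lact -tsum_split; apply: eq_tsum => w f.
  by rewrite scalerDl tpureDl.
- exact: tsumD (OmF_l_balanced _).
- rewrite adjZl // {2}/OmF_l /OmF_k.
  rewrite [RHS](tsum_lact _ _ _ (OmF_l_balanced _)); apply: eq_tsum => w f.
  by rewrite /kscale scalerA mulr_algr.
Qed.

(** The right action of B on Omega (x)_B F is again given by the coaction and
  the adjoint action.  On w (x) f it is w (x) ad(f_(-1))(b) f_(0); moving the
  coefficient across makes it act on w from the right, hence through
  ad(w_(-1)), and the two adjoint actions compose to ad(w_(-1) f_(-1)). *)
Lemma OmF_coact_adj (t : OmF Om F) (b : B) :
  \sw_(a, u <- OmF_coact deltaOm t) OmF_l (adj a b) u = OmF_r t b.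
Proof.
have bal := OmF_l_adj_balanced b.
rewrite [LHS](tsum_tsum _ _ bal); apply: eq_tsum => w f.
rewrite [LHS](tsum_tsum _ _ bal).
under eq_tsum => a w' do rewrite (tsum_tsum _ _ bal).
rewrite exchange_tsum [RHS]tpure_tsumr; apply: eq_tsum => c f'.
rewrite -tpure_bal Om_mod0 [RHS]tpure_tsuml; apply: eq_tsum => a w'.
by rewrite (tsum_pure _ _ bal) OmF_l_pure adjM.
Qed.

(** Expanding nabla(f b) = nabla(ad(f_(-1))(b) f_(0)) by the Leibniz rule, the
  terms without d sum to ad(f_(-1))(b) nabla(f_(0)).  By covariance this is
  the coaction of nabla(f) paired with ad(-)(b), that is, nabla(f) b. *)
Lemma bimodule_map_dif (nabla : F -> OmF Om F) (sigma : FOm Om F -> OmF Om F)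
    (f : F) (b : B) :
  connection nabla -> covariant_connection deltaOm nabla ->
  bimodule_map_of nabla sigma ->
  sigma (fom f (dif Om b)) = \sw_(a, g <- coact f) omf (dif Om (adj a b)) g.
Proof.
case=> nablaD _ nablaM cov [_ _ _ nablaR].
have := nablaR f b; rewrite {1}/ract0 [X in X = _](morphD_sum nablaD).
under eq_bigr => p _ do rewrite nablaM.
rewrite big_split /= -OmF_coact_adj cov (tsum_tsum _ _ (OmF_l_adj_balanced b)).
rewrite [LHS]addrC.
under [in RHS]eq_tsum => a g do rewrite (tsum_pure _ _ (OmF_l_adj_balanced b)).
by move/addrI.
Qed.

(** F (x)_B Omega is spanned by the f (x) db: in f (x) c db the coefficient c
  can be moved to f. *)
Lemma eq_bimodule_map (sigma sigma' : FOm Om F -> OmF Om F) :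
  {morph sigma : s t / s + t} -> {morph sigma' : s t / s + t} ->
  (forall f b, sigma (fom f (dif Om b)) = sigma' (fom f (dif Om b))) ->
  sigma = sigma'.
Proof.
move=> sD s'D e; apply: funext => t.
rewrite [t]tens_pureE (morphD_sum sD) (morphD_sum s'D).
apply: eq_bigr => -[f w] _ /=; have [s ->] := dif_gen w.
rewrite [tpure _ _ _ _]tpure_sumr (morphD_sum sD) (morphD_sum s'D).
by apply: eq_bigr => p _; rewrite -tpure_bal; exact: e.
Qed.

End BimoduleMap.

Theorem lemma4p1 (R : realType) (A : hopfAlg R[i]) (B : coidealSubalg A)
    (B_qhs : quantum_homogeneous B)
    (Om : fodc B) (deltaOm : Om -> lcoact A Om)
    (Om_covariant : covariant_calculus deltaOm)
    (Om_mod0 : forall (w : Om) (b : B), rscale w b = ract0 deltaOm w b)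
    (F : relHopfMod B) :
  (forall (nabla : F -> OmF Om F) (sigma : FOm Om F -> OmF Om F),
     connection nabla -> covariant_connection deltaOm nabla ->
     bimodule_map_of nabla sigma ->
     forall (f : F) (b : B),
       sigma (fom f (dif Om b)) =
       \sw_(a, g <- coact f) omf (dif Om (adj a b)) g)
  /\
  (forall (nabla nabla' : F -> OmF Om F) (sigma sigma' : FOm Om F -> OmF Om F),
     connection nabla -> covariant_connection deltaOm nabla ->
     bimodule_map_of nabla sigma ->
     connection nabla' -> covariant_connection deltaOm nabla' ->
     bimodule_map_of nabla' sigma' ->
     sigma = sigma').
Proof.
split=> [nabla sigma conn cov bim f b|].
  exact: bimodule_map_dif conn cov bim.
move=> nabla nabla' sigma sigma' conn cov bim conn' cov' bim'.
apply: eq_bimodule_map => [||f b]; [by case: bim | by case: bim' | ].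
rewrite (bimodule_map_dif B_qhs Om_mod0 f b conn cov bim).
by rewrite (bimodule_map_dif B_qhs Om_mod0 f b conn' cov' bim').
Qed.
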